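(* Let $F$ be an arbitrary field (of any characteristic, finite or infinite). There is no subset $A\subseteq F$ with $|A|=6$ and $|A+A|>|A-A|$; that is, no MSTD set of size six exists in $F$.
   Context: For a finite subset $A$ of a field $F$ (viewed as an additive abelian group), $A+A=\{a_1+a_2: a_1,a_2\in A\}$ and $A-A=\{a_1-a_2: a_1,a_2\in A\}$. The set $A$ is called a More Sums Than Differences (MSTD) set if $|A+A|>|A-A|$. *)

(* Defs.v *)
From mathcomp Require Import all_boot all_order all_algebra.
From mathcomp Require Import finmap.

Set Implicit Arguments.
Unset Strict Implicit.
Unset Printing Implicit Defensive.

Definition sumset (V : zmodType) (A B : {fset V}) : {fset V} :=
  [fset (a + b)%R | a in A, b in B]%fset.

Definition diffset (V : zmodType) (A B : {fset V}) : {fset V} :=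
  [fset (a - b)%R | a in A, b in B]%fset.

(* More Sums Than Differences. *)
Definition MSTD (V : zmodType) (A : {fset V}) : Prop :=
  (#|` diffset A A| < #|` sumset A A|)%N.

(* Main.v *)
Require Import Defs.
From Stdlib Require Import ZArith.
From mathcomp Require Import all_boot all_order all_algebra.
From mathcomp Require Import finmap.
From mathcomp Require Import ssrZ zify ring.

(* Everything is decided by which relations a_i + a_j = a_k + a_l hold between
   the six elements, because d - d' = 0 for two differences d, d' is such a
   relation.  A binary search over these relations refutes every possibility:
   if a relation holds, it is used to eliminate a parameter from a linear
   parametrization of (a_0, ..., a_5), which may force further sums to agree;
   if it fails, more differences are known to be distinct.  A branch is closed
   once the number of known distinct differences reaches the number of formally
   distinct sums, or once a relation already excluded becomes a consequence of
   the parametrization.  Eliminations are fraction-free over Z; when a pivot is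
   not known to be invertible in F, the search also branches on whether one of
   its prime factors is the characteristic.  In characteristic 2 sums and
   differences coincide.  Up to reordering one may start from a_0 + a_1 =
   a_2 + a_3, or, if no such relation between four distinct elements holds,
   from a_0 + a_2 = 2 a_1, or else from a set without any relation. *)

Set Implicit Arguments.
Unset Strict Implicit.
Unset Printing Implicit Defensive.

Import GRing.Theory.

(* Integer linear forms and the refutation search *)
Delimit Scope Z_scope with coqZ.

(* The modulus [p] is 0 as long as the characteristic is undetermined;
   this works because [Z.modulo z 0 = z]. *)
Fixpoint comb (p a : Z) (u : seq Z) (b : Z) (v : seq Z) : seq Z :=
  match u, v with
  | [::], _ => [seq ((b * d) mod p)%coqZ | d <- v]
  | _, [::] => [seq ((a * c) mod p)%coqZ | c <- u]
  | c :: u', d :: v' => ((a * c + b * d) mod p)%coqZ :: comb p a u' b v'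
  end.

Definition isz : pred (seq Z) := all (fun c => Z.eqb c 0%coqZ).
Definition eqz : rel (seq Z) := all2 Z.eqb.

(* [(i, j, k, l)] encodes the relation a_i + a_j = a_k + a_l. *)
Notation quad := (nat * nat * nat * nat)%type.

Definition row (M : seq (seq Z)) i := nth [::] M i.

Definition sumform p M i j := comb p 1%coqZ (row M i) 1%coqZ (row M j).
Definition relform p M (q : quad) :=
  let: (i, j, k, l) := q in comb p 1%coqZ (sumform 0%coqZ M i j) (-1)%coqZ (sumform 0%coqZ M k l).

Fixpoint reps (T : Type) (e : rel T) (s : seq T) : seq T :=
  if s is x :: s' then
    let r := reps e s' in if has (e x) r then r else x :: r
  else [::].

Definition nsums p M : nat :=
  size (reps eqz [seq sumform p M i j | i <- iota 0 6, j <- iota i (6 - i)]).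

Definition edges : seq (nat * nat) := [seq (i, j) | i <- iota 0 6, j <- iota 0 i].

(* One edge for each difference, up to sign, that is distinct as a form. *)
Definition edge_reps p M : seq (nat * nat) :=
  let E := [seq (e, comb p 1%coqZ (row M e.1) (-1)%coqZ (row M e.2)) | e <- edges] in
  rev (unzip1 (reps (fun u v => eqz u.2 v.2 || isz (comb p 1%coqZ u.2 1%coqZ v.2)) (rev E))).

Notation table := (seq (seq (seq (seq bool)))).

(** An absent entry reads [false], which means undecided. *)
Definition known (N : table) (q : quad) : bool :=
  let: (i, j, k, l) := q in
  nth false (nth [::] (nth [::] (nth [::] N i) j) k) l.

Definition put (N : table) (q : quad) : table :=
  let: (i, j, k, l) := q in
  let N1 := nth [::] N i in let N2 := nth [::] N1 j in let N3 := nth [::] N2 k in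
  set_nth [::] N i (set_nth [::] N1 j (set_nth [::] N2 k (set_nth false N3 l true))).

(** All rewritings of a relation are stored, so lookups need no normal form. *)
Definition variants (q : quad) : seq quad :=
  let: (i, j, k, l) := q in
  [:: (i, j, k, l); (j, i, k, l); (i, j, l, k); (j, i, l, k);
      (k, l, i, j); (k, l, j, i); (l, k, i, j); (l, k, j, i)].

Definition puts N q := foldl put N (variants q).

(** For each [f], the two relations say that the difference along [e] equals the one along [f], or
    its negative. *)
Definition blockers N (e : nat * nat) (D : seq (nat * nat)) : seq quad :=
  flatten [seq [seq q <- [:: (e.1, f.2, f.1, e.2); (e.1, f.1, e.2, f.2)] | ~~ known N q]
          | f <- D].

(* [D] collects edges whose differences are known to be nonzero and pairwise
   distinct up to sign; [best] is an undecided relation from an edge that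
   the fewest undecided relations keep out of [D]. *)
Fixpoint greedy N es D (best : option (nat * quad)) :=
  if es is e :: es' then
    if blockers N e D is q :: b then
      let m := size b in
      greedy N es' D (if best is Some (m', _) then if m < m' then Some (m, q) else best
                      else Some (m, q))
    else greedy N es' (if [&& e.1 < 6, e.2 < 6 & known N (e.1, e.1, e.2, e.2)]
                    then e :: D else D) best
  else (D, best).

Definition inconsistent p M (no : seq quad) := has (fun q => isz (relform p M q)) no.

(** Factors shared with [n] are invertible in the field, so dividing them out of [g] does not affect
    whether [g] vanishes there; [k] is fuel. *)
Fixpoint strip k n g :=
  let d := Z.gcd n g in
  if k is k'.+1 then if (d =? 1)%coqZ then g else strip k' n (g / d)%coqZ else g.

(** Any value is sound, as [search] splits on whether it vanishes in the field; a divisor found in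
    the list is prime, being the least above 1. *)
Definition least_factor g :=
  head g [seq q <- [seq Z.of_nat i | i <- iota 2 40] | (g mod q =? 0)%coqZ].

Definition pivot p M v j :=
  let c := nth 0%coqZ v j in
  [seq comb p c m (Z.opp (nth 0%coqZ m j)) v | m <- M].

(* In the field, [p] vanishes and [n] does not.  [s] bounds the number of sums,
   [N] and [no] record relations that fail, and [todo] is a relation assumed to
   hold but not yet used in [M].  The conditionals replace [&&] and [||], whose
   arguments [vm_compute] evaluates eagerly. *)
Fixpoint search (fuel : nat) (p n : Z) (M : seq (seq Z)) (es : seq (nat * nat)) (s : nat)
   (N : table) (no : seq quad) (todo : option quad) : bool :=
  if fuel is f.+1 then
    if todo is Some r then
      let v := relform p M r in
      if isz v then search f p n M (edge_reps p M) (nsums p M) N no None else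
      let j := find (fun c => ~~ (Z.eqb c 0%coqZ)) v in
      let g := strip 40 n (Z.gcd (nth 0%coqZ v j) p) in
      if (g =? 1)%coqZ then
        let M' := pivot p M v j in
        if inconsistent p M' no then true
        else search f p n M' (edge_reps p M') (nsums p M') N no None
      else
        let q := least_factor g in
        let M' := [seq comb q 1%coqZ m 0%coqZ [::] | m <- M] in
        if (if inconsistent q M' no then true else search f q n M' es s N no (Some r))
        then search f p (Z.mul n q) M es s N no (Some r) else false
    else
      let: (D, best) := greedy N es [::] None in
      if s <= (size D).*2.+1 then true else
      if best is Some (_, r) then
        if search f p n M es s N no (Some r)
        then search f p n M es s (puts N r) (r :: no) None else false
      else false
  else false.

(** These fail for distinct elements: adding a_0 or, when 2 is invertible, doubling keeps them
    distinct. *)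
Definition trivial_quads : seq quad :=
  [seq (e.1, 0, e.2, 0) | e <- edges] ++ [seq (e.1, e.1, e.2, e.2) | e <- edges].

Definition parallelograms : seq quad :=
  [seq q <- [seq (e.1, e.2, f.1, f.2) | e <- edges, f <- edges] |
    let: (i, j, k, l) := q in uniq [:: i; j; k; l]].

Definition midpoints : seq quad :=
  [seq q <- [seq (e.1, e.2, k, k) | e <- edges, k <- iota 0 6] |
    let: (i, j, k, _) := q in uniq [:: i; j; k]].

Definition id_rows : seq (seq Z) :=
  [seq [seq (if i == j then 1%coqZ else 0%coqZ) | j <- iota 0 6] | i <- iota 0 6].

(** Initially the six elements are their own parameters, modulus 0 leaves the characteristic open,
    and 2 counts as invertible. *)
Definition run (no : seq quad) (todo : option quad) : bool :=
  search 200 0%coqZ 2%coqZ id_rows edges (nsums 0%coqZ id_rows) (foldl puts [::] no) no todo.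

Definition arrange (p : seq nat) : seq nat := p ++ [seq m <- iota 0 6 | m \notin p].

(** * Evaluation of integer forms in the field *)

Section Soundness.
Local Open Scope ring_scope.
Variable F : fieldType.

Definition ofZ (z : Z) : F := (int_of_Z z)%:~R.

Lemma ofZD a b : ofZ (Z.add a b) = ofZ a + ofZ b.
Proof. by rewrite /ofZ -intrD; congr _%:~R; lia. Qed.

Lemma ofZM a b : ofZ (Z.mul a b) = ofZ a * ofZ b.
Proof. by rewrite /ofZ -intrM; congr _%:~R; lia. Qed.

Lemma ofZ1 : ofZ 1%coqZ = 1. Proof. by []. Qed.
Lemma ofZN1 : ofZ (-1)%coqZ = -1. Proof. by []. Qed.
Lemma ofZ0 : ofZ 0%coqZ = 0. Proof. by []. Qed.

Lemma ofZ_mod p z : ofZ p = 0 -> ofZ (Z.modulo z p) = ofZ z.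
Proof.
move=> p0; rewrite [in RHS](Z_div_mod_eq_full z p) ofZD ofZM p0.
by rewrite mul0r add0r.
Qed.

Lemma ofZ_dvd d z : Z.divide d z -> ofZ d = 0 -> ofZ z = 0.
Proof. by case=> m -> d0; rewrite ofZM d0 mulr0. Qed.

Lemma ofZ_gcd a b : ofZ a = 0 -> ofZ b = 0 -> ofZ (Z.gcd a b) = 0.
Proof.
move=> a0 b0; have [u [v <-]] := Z.gcd_bezout a b _ erefl.
by rewrite ofZD !ofZM a0 b0 !mulr0 addr0.
Qed.

Lemma ofZ_strip k n g : ofZ n != 0 -> ofZ g = 0 -> ofZ (strip k n g) = 0.
Proof.
move=> n0; elim: k g => //= k IH g g0; case: ifP => // _; apply: IH.
have [m gE] := Z.gcd_divide_r n g.
have d0 : ofZ (Z.gcd n g) != 0.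
  by apply: contra_neq n0 => /ofZ_dvd; apply; apply: Z.gcd_divide_l.
have dn0 : Z.gcd n g <> Z0 by move=> d; rewrite d ofZ0 eqxx in d0.
move: g0; rewrite [in ofZ g]gE ofZM => /eqP; rewrite mulf_eq0 (negPf d0) orbF.
by move=> /eqP m0; rewrite [X in Z.div X _]gE Z.div_mul.
Qed.

Fixpoint ev (x : seq F) (v : seq Z) : F :=
  if x is t :: x' then if v is c :: v' then ofZ c * t + ev x' v' else 0 else 0.

Lemma ev_nil x : ev x [::] = 0.
Proof. by case: x. Qed.

Lemma ev_scale p b x v : ofZ p = 0 ->
  ev x [seq Z.modulo (Z.mul b d) p | d <- v] = ofZ b * ev x v.
Proof.
move=> p0; elim: x v => [|t x IH] [|d v] /=; rewrite ?mulr0 //.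
by rewrite IH ofZ_mod // ofZM mulrDr mulrA.
Qed.

Lemma ev_comb p a u b v x : ofZ p = 0 ->
  ev x (comb p a u b v) = ofZ a * ev x u + ofZ b * ev x v.
Proof.
move=> p0; elim: u v x => [|c u IH] [|d v] x.
- by rewrite /= ev_nil !mulr0 addr0.
- by rewrite [comb _ _ _ _ _]/= (ev_scale b x (d :: v) p0) ev_nil mulr0 add0r.
- by rewrite [comb _ _ _ _ _]/= (ev_scale a x (c :: u) p0) ev_nil mulr0 addr0.
case: x => [|t x] /=; first by rewrite !mulr0 addr0.
by rewrite IH ofZ_mod // ofZD !ofZM; ring.
Qed.

Lemma ev_isz x v : isz v -> ev x v = 0.
Proof.
elim: v x => [|c v IH] [|t x] //= /andP[]; case: Z.eqb_spec => // c0 _ /IH v0.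
by rewrite c0 v0 ofZ0 mul0r addr0.
Qed.

Lemma eqzP u v : eqz u v -> u = v.
Proof. by elim: u v => [|c u IH] [|d v] //= /andP[]; case: Z.eqb_spec => // -> _ /IH->. Qed.

Lemma ev_divr x v c : ev [seq t / c | t <- x] v = ev x v / c.
Proof.
elim: x v => [|t x IH] [|d v] /=; rewrite ?mul0r //.
by rewrite IH mulrDl mulrA.
Qed.

(** A discarded element is [e]-related to a kept one, which inherits [P]. *)
Lemma has_reps (T : Type) (e : rel T) (P : T -> Prop) s :
  (forall x y, e x y -> P x -> P y) ->
  (exists2 i, (i < size s)%N & forall d, P (nth d s i)) ->
  (exists2 i, (i < size (reps e s))%N & forall d, P (nth d (reps e s) i)).
Proof.
move=> eP; elim: s => [[]|x s IH] //= [[|i] /= lti Pi].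
  case: ifP => [/(has_nthP x)[j ltj exj] | _]; last by exists 0%N.
  exists j => // d; rewrite (set_nth_default x) //.
  exact: eP exj (Pi x).
have [|j ltj Pj] := IH; first by exists i.
by case: ifP => _; [exists j | exists j.+1].
Qed.

(** * Parametrizations and the bound on sums *)

Variable a : seq F.
Hypothesis size_a : size a = 6%N.

Definition holds (q : quad) : Prop :=
  let: (i, j, k, l) := q in a`_i + a`_j = a`_k + a`_l.

Definition models (x : seq F) M := forall i, ev x (row M i) = a`_i.

Lemma ev_sumform p x M i j : ofZ p = 0 -> models x M ->
  ev x (sumform p M i j) = a`_i + a`_j.
Proof. by move=> p0 Mx; rewrite ev_comb // !Mx ofZ1 !mul1r. Qed.

Lemma ev_relform p x M i j k l : ofZ p = 0 -> models x M ->
  ev x (relform p M (i, j, k, l)) = a`_i + a`_j - (a`_k + a`_l).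
Proof.
move=> p0 Mx; rewrite ev_comb // !(ev_sumform _ _ ofZ0 Mx) ofZ1 ofZN1.
by rewrite mul1r mulN1r.
Qed.

Lemma relform_isz p x M q : ofZ p = 0 -> models x M ->
  isz (relform p M q) -> holds q.
Proof.
case: q => [[[i j] k] l] p0 Mx /(ev_isz x); rewrite (ev_relform _ _ _ _ p0 Mx).
by move/eqP; rewrite subr_eq0 => /eqP.
Qed.

Lemma models_map x y M f : (forall v, ev y (f v) = ev x v) -> models x M ->
  models y [seq f v | v <- M].
Proof.
move=> fE Mx i; rewrite /row; have [ltiM | leMi] := ltnP i (size M).
  by rewrite (nth_map [::]) // fE Mx.
by rewrite nth_default ?size_map // -Mx /row nth_default // !ev_nil.
Qed.

Lemma models_mod q x M : ofZ q = 0 -> models x M ->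
  models x [seq comb q 1%coqZ m 0%coqZ [::] | m <- M].
Proof.
move=> q0; apply: models_map => v.
by rewrite ev_comb // ofZ1 ofZ0 mul1r mul0r addr0.
Qed.

(** Since [v] vanishes at [x], each new row takes there its old value times the pivot; dividing the
    parameters by the pivot restores it. *)
Lemma models_pivot p x M q j : let v := relform p M q in
  ofZ p = 0 -> ofZ (nth Z0 v j) != 0 -> holds q -> models x M ->
  exists y, models y (pivot p M v j).
Proof.
case: q => [[[i k] l] m] v p0 c0 hq Mx.
exists [seq t / ofZ (nth Z0 v j) | t <- x]; apply: (models_map _ Mx) => w.
have v0 : ev x v = 0 by rewrite (ev_relform _ _ _ _ p0 Mx) hq subrr.
by rewrite ev_divr ev_comb // v0 mulr0 addr0 mulrC mulKf.
Qed.

Definition sums := [seq x + y | x <- a, y <- a].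
Definition diffs := [seq x - y | x <- a, y <- a].

(** Equal forms take equal values, so the kept forms still reach every sum; by commutativity index
    pairs with i <= j suffice. *)
Lemma size_sums p x M : ofZ p = 0 -> models x M -> (size (undup sums) <= nsums p M)%N.
Proof.
move=> p0 Mx; pose S := [seq sumform p M i j | i <- iota 0 6, j <- iota i (6 - i)].
rewrite /nsums -/S.
have evS i j : (i <= j)%N -> (j < 6)%N ->
    exists2 n, (n < size S)%N & forall d, ev x (nth d S n) = a`_i + a`_j.
  move=> lei ltj; have : sumform p M i j \in S.
    apply/allpairsPdep; exists i, j; split=> //; rewrite mem_iota.
      by rewrite (leq_ltn_trans lei).
    by rewrite lei subnKC // ltnW // (leq_ltn_trans lei).
  move=> /(nthP [::])[n ltn nE]; exists n => // d.
  by rewrite (set_nth_default [::]) // nE (ev_sumform _ _ p0 Mx).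
move: S evS => S evS; rewrite -(size_map (ev x)).
apply: uniq_leq_size (undup_uniq _) _ => z zs.
have {zs} /allpairsP[[u v] /= [ua va ->]] : z \in sums by rewrite -mem_undup.
have [i [j [lei ltj ->]]] : exists i j, [/\ (i <= j)%N, (j < 6)%N & u + v = a`_i + a`_j].
  have [lt_iv lt_jv] : (index u a < 6)%N /\ (index v a < 6)%N by rewrite -size_a !index_mem.
  have [le|/ltnW le] := leqP (index u a) (index v a); [exists (index u a), (index v a) |
    exists (index v a), (index u a)]; by rewrite !nth_index // 1?addrC.
have [|n ltn nE] := @has_reps _ eqz (fun w => ev x w = a`_i + a`_j) S _ (evS i j lei ltj).
  by move=> w w' /eqzP->.
by apply/(nthP 0); exists n; rewrite ?size_map // (nth_map [::]).
Qed.

(** * Certified distinct differences *)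

Definition refuted (N : table) := forall q, known N q -> ~ holds q.

Lemma known_put N q r : known (put N q) r -> r = q \/ known N r.
Proof.
case: q r => [[[i j] k] l] [[[i' j'] k'] l'] /=.
rewrite nth_set_nth /=; case: eqP => [->|_]; last by right.
rewrite nth_set_nth /=; case: eqP => [->|_]; last by right.
rewrite nth_set_nth /=; case: eqP => [->|_]; last by right.
by rewrite nth_set_nth /=; case: eqP => [->|_]; [left | right].
Qed.

Lemma refuted_puts N q : refuted N -> ~ holds q -> refuted (puts N q).
Proof.
move=> Nr nq; rewrite /puts.
have : forall r, r \in variants q -> ~ holds r.
  case: q nq => [[[i j] k] l] /= nq r; rewrite !inE.
  by do !case/orP; move/eqP=> -> hr; apply: nq; move: hr => /=;
     rewrite ?[a`_j + a`_i]addrC ?[a`_l + a`_k]addrC => ->.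
elim: (variants q) N Nr => //= r s IH N Nr sN; apply: IH => [t|t ts]; last first.
  by apply: sN; rewrite inE ts orbT.
by case/known_put => [-> | /Nr //]; apply: sN; rewrite inE eqxx.
Qed.

Definition dif (e : nat * nat) := a`_e.1 - a`_e.2.
Definition difs D := foldr (fun e l => [:: dif e, - dif e & l]) [:: 0] D.

Lemma size_difs D : size (difs D) = (size D).*2.+1.
Proof. by elim: D => //= e D ->. Qed.

Lemma mem_difs D z : z \in difs D -> z = 0 \/ exists2 f, f \in D & z = dif f \/ z = - dif f.
Proof.
elim: D => [|e D IH] /=; first by rewrite inE => /eqP; left.
rewrite !inE => /or3P[/eqP-> | /eqP-> | /IH[->|[f fD zE]]].
- by right; exists e; rewrite ?inE ?eqxx //; left.
- by right; exists e; rewrite ?inE ?eqxx //; right.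
- by left.
- by right; exists f; rewrite ?inE ?fD ?orbT.
Qed.

Lemma opp_difs D z : z \in difs D -> - z \in difs D.
Proof.
elim: D => [|e D IH] /=; first by rewrite !inE oppr_eq0.
rewrite !inE => /or3P[/eqP-> | /eqP-> | /IH->]; last by rewrite !orbT.
  by rewrite eqxx orbT.
by rewrite opprK eqxx.
Qed.

Definition good D := uniq (difs D) /\ {subset difs D <= diffs}.

Lemma mem_diffs i j : (i < 6)%N -> (j < 6)%N -> a`_i - a`_j \in diffs.
Proof. by move=> lti ltj; apply: allpairs_f; rewrite mem_nth ?size_a. Qed.

(** If [dif e] were plus or minus some [dif f], a refuted relation would hold; if it were 0 or its
    own negative, the doubles of the two ends of [e] would agree, also refuted. *)
Lemma good_cons N e D : refuted N -> good D -> blockers N e D = [::] ->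
  [&& e.1 < 6, e.2 < 6 & known N (e.1, e.1, e.2, e.2)]%N -> good (e :: D).
Proof.
move=> Nr [uD sD] eD /and3P[lt1 lt2 /Nr /= ne].
have kD f : f \in D -> known N (e.1, f.2, f.1, e.2) /\ known N (e.1, f.1, e.2, f.2).
  move=> fD; split; apply: contraT => nk.
    suff: (e.1, f.2, f.1, e.2) \in blockers N e D by rewrite eD.
    by apply/flatten_mapP; exists f => //; rewrite mem_filter nk inE eqxx.
  suff: (e.1, f.1, e.2, f.2) \in blockers N e D by rewrite eD.
  by apply/flatten_mapP; exists f => //; rewrite mem_filter nk !inE eqxx orbT.
have eD' : dif e \notin difs D.
  apply/negP => /mem_difs[d0|[f /kD[/Nr n1 /Nr n2] dE]].
    by apply: ne; move/eqP: d0; rewrite subr_eq0 => /eqP->.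
  case: dE => dE; [apply: n1 | apply: n2]; rewrite /= -[a`_e.1](subrK a`_e.2).
    by rewrite -/(dif e) dE /dif; ring.
  by rewrite -/(dif e) dE /dif; ring.
have neD : - dif e \notin difs D by apply: contra eD' => /opp_difs; rewrite opprK.
have nn : dif e != - dif e.
  apply/eqP => dE; apply: ne.
  have d0 : dif e + dif e = 0 by rewrite {1}dE addNr.
  have -> : a`_e.1 + a`_e.1 = (dif e + dif e) + (a`_e.2 + a`_e.2) by rewrite /dif; ring.
  by rewrite d0 add0r.
split; first by rewrite /= inE negb_or nn eD' neD.
move=> z; rewrite /= !inE => /or3P[/eqP-> | /eqP-> | /sD //]; first exact: mem_diffs.
by rewrite opprB mem_diffs.
Qed.

Lemma good_greedy N es D best : refuted N -> good D -> good (greedy N es D best).1.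
Proof.
move=> Nr; elim: es D best => //= e es IH D best gD.
case E: (blockers N e D) => [|q b]; last exact: IH.
by apply: IH; case: ifP => // /(good_cons Nr gD E).
Qed.

(** * Soundness of the search *)

Definition not_mstd := (size (undup sums) <= size (undup diffs))%N.

Lemma inconsistentF p M no x : ofZ p = 0 -> models x M ->
  (forall q, q \in no -> ~ holds q) -> inconsistent p M no = false.
Proof.
move=> p0 Mx noP; apply/negP => /hasP[q qno /(relform_isz p0 Mx)]; exact: noP.
Qed.

Lemma search_sound fuel p n M es s N no todo x :
  ofZ p = 0 -> ofZ n != 0 -> models x M -> (size (undup sums) <= s)%N ->
  refuted N -> (forall q, q \in no -> ~ holds q) ->
  (forall r, todo = Some r -> holds r) ->
  search fuel p n M es s N no todo -> not_mstd.
Proof.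
elim: fuel p n M es s N no todo x => [//|f IH] p n M es s N no todo x p0 n0 Mx les Nr noP tP.
cbn [search]; case: todo tP => [r|] tP.
  have hr := tP r erefl; have noT : forall r, None = Some r -> holds r by [].
  case: ifP => _; first exact: (IH _ _ _ _ _ _ _ _ _ p0 n0 Mx (size_sums p0 Mx) Nr noP noT).
  set v := relform p M r; set j := find _ _; set g := strip _ _ _.
  case: Z.eqb_spec => [g1 | _].
    have c0 : ofZ (nth Z0 v j) != 0.
      (* A vanishing pivot would make its gcd with [p] vanish and, after removal of invertible
         factors, also [g], which is 1. *)
      apply/eqP => c0; have := ofZ_strip 40 n0 (ofZ_gcd c0 p0).
      by rewrite -/g g1 => /eqP; rewrite oner_eq0.
    have [y My] := models_pivot p0 c0 hr Mx.
    rewrite (inconsistentF p0 My noP).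
    exact: (IH _ _ _ _ _ _ _ _ _ p0 n0 My (size_sums p0 My) Nr noP noT).
  set q := least_factor g; case: ifP => // Hq Hn.
  (* If [q] vanishes it becomes the modulus; otherwise it is multiplied into the invertible [n]. *)
  have [q0|q0] := eqVneq (ofZ q) 0; last first.
    by apply: (IH _ _ _ _ _ _ _ _ _ p0 _ Mx les Nr noP tP Hn); rewrite ofZM mulf_neq0.
  have Mq := models_mod q0 Mx; move: Hq; rewrite (inconsistentF q0 Mq noP).
  exact: (IH _ _ _ _ _ _ _ _ _ q0 n0 Mq les Nr noP tP).
case E: greedy => [D best]; case: ifP => [leD _ | _].
  have [uD sD] : good D.
    rewrite -[D]/(D, best).1 -E; apply: good_greedy => //; split=> // z.
    by rewrite inE => /eqP->; rewrite -(subrr a`_0) mem_diffs.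
  (* The number of sums is at most [s], hence at most the size 2|D| + 1 of [difs D], whose entries
     are distinct differences. *)
  apply: leq_trans les _; apply: leq_trans leD _; rewrite -size_difs.
  by apply: uniq_leq_size => // z /sD; rewrite mem_undup.
case: best {E} => [[m r]|] //; case: ifP => // Hr Hn.
have [hr|nr] := eqVneq (a`_r.1.1.1 + a`_r.1.1.2) (a`_r.1.2 + a`_r.2).
  apply: (IH _ _ _ _ _ _ _ _ _ p0 n0 Mx les Nr noP _ Hr) => _ [<-].
  by case: r hr {Hr Hn} => [[[]]].
have {}nr : ~ holds r by case: r nr {Hr Hn} => [[[i j] k] l] /= /eqP.
apply: (IH _ _ _ _ _ _ _ _ _ p0 n0 Mx les (refuted_puts Nr nr) _ tP Hn) => q.
by rewrite inE => /orP[/eqP-> // | /noP].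
Qed.

End Soundness.

(** * The three computations *)

Lemma run_parallelogram : run trivial_quads (Some (0, 1, 2, 3)%N).
Proof. vm_cast_no_check isT. Qed.

Lemma run_midpoint : run (trivial_quads ++ parallelograms) (Some (0, 2, 1, 1)%N).
Proof. vm_cast_no_check isT. Qed.

Lemma run_sidon : run (trivial_quads ++ parallelograms ++ midpoints) None.
Proof. vm_cast_no_check isT. Qed.

Lemma mem_edges e : e \in edges -> (e.2 < e.1 < 6)%N.
Proof. by move: e; apply/allP. Qed.

Lemma perm_arrange_parallelogram i j k l : (i, j, k, l) \in parallelograms ->
  perm_eq (arrange [:: i; j; k; l]) (iota 0 6).
Proof.
have /allP H : all (fun q : quad => let: (i, j, k, l) := q in
  perm_eq (arrange [:: i; j; k; l]) (iota 0 6)) parallelograms by vm_compute.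
by move/H.
Qed.

Lemma perm_arrange_midpoint i j k l : (i, j, k, l) \in midpoints ->
  k = l /\ perm_eq (arrange [:: i; k; j]) (iota 0 6).
Proof.
have /allP H : all (fun q : quad => let: (i, j, k, l) := q in
  (k == l) && perm_eq (arrange [:: i; k; j]) (iota 0 6)) midpoints by vm_compute.
by move/H => /andP[/eqP].
Qed.

(** * Reduction to the three starting positions *)

Section Conclusion.
Local Open Scope ring_scope.
Variable F : fieldType.
Implicit Types a b : seq F.

Lemma models_id a : size a = 6%N -> models a a id_rows.
Proof.
case: a => [|x0 [|x1 [|x2 [|x3 [|x4 [|x5 [|]]]]]]] //= _.
by case=> [|[|[|[|[|[|i]]]]]]; rewrite /row /= ?nth_nil /= ?(ofZ0, ofZ1); ring.
Qed.

Lemma run_sound a no todo : size a = 6%N -> (2%:R : F) != 0 ->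
  (forall q, q \in no -> ~ holds a q) -> (forall r, todo = Some r -> holds a r) ->
  run no todo -> not_mstd a.
Proof.
move=> size_a two0 noP tP.
have Ma := models_id size_a; have p0 : ofZ F Z0 = 0 by [].
have {}two0 : ofZ F 2%coqZ != 0 by [].
rewrite /run; apply: (search_sound size_a p0 two0 Ma (size_sums size_a p0 Ma) _ noP tP).
have : refuted a [::] by case=> [[[i j] k] l]; rewrite /= !nth_nil.
elim: no [::] noP => //= q no IH N noP Nr; apply: IH => [r rno|].
  by apply: noP; rewrite inE rno orbT.
by apply: refuted_puts => //; apply: noP; rewrite inE eqxx.
Qed.

Lemma trivial_quads_not_held a q : size a = 6%N -> uniq a -> (2%:R : F) != 0 ->
  q \in trivial_quads -> ~ holds a q.
Proof.
move=> size_a ua two0; rewrite mem_cat.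
have neq e : e \in edges -> a`_e.1 <> a`_e.2.
  move/mem_edges => /andP[lt21 lt16] /eqP.
  by rewrite nth_uniq ?size_a ?(ltn_trans lt21) // eq_sym ltn_eqF.
case/orP=> /mapP[e /neq ne ->] /=; first by move/addIr.
rewrite -!mulr2n -[a`_e.1 *+ 2]mulr_natr -[a`_e.2 *+ 2]mulr_natr.
by move/(mulIf two0).
Qed.

Lemma not_mstd_perm a b : perm_eq a b -> not_mstd a -> not_mstd b.
Proof.
move=> /perm_mem ab; rewrite /not_mstd.
suff E (f : F -> F -> F) : size (undup [seq f x y | x <- a, y <- a])
    = size (undup [seq f x y | x <- b, y <- b]) by rewrite /sums /diffs !E.
apply/perm_size/perm_undup => z; apply/allpairsP/allpairsP.
  by move=> [p [p1 p2 ->]]; exists p; rewrite -!ab.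
by move=> [p [p1 p2 ->]]; exists p; rewrite !ab.
Qed.

Lemma perm_reorder a p : size a = 6%N -> perm_eq p (iota 0 6) ->
  perm_eq [seq a`_i | i <- p] a.
Proof.
move=> size_a /(perm_map (nth 0 a)); rewrite -size_a.
by rewrite -/(mkseq _ _) mkseq_nth.
Qed.

Lemma not_mstd_size6 a : uniq a -> size a = 6%N -> not_mstd a.
Proof.
move=> ua size_a; have [two0|two0] := eqVneq (2%:R : F) 0.
  suff E : sums a = diffs a by rewrite /not_mstd E.
  have opp y : - y = y :> F.
    by apply/eqP; rewrite eq_sym -addr_eq0 -mulr2n -mulr_natr two0 mulr0.
  by apply: eq_allpairs => x y; rewrite opp.
have perm_hyps b : perm_eq b a -> size b = 6%N /\ uniq b.
  by move=> ba; rewrite (perm_size ba) (perm_uniq ba).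
have [/hasP[b] | no4] := boolP (has (fun b => b`_0 + b`_1 == b`_2 + b`_3) (permutations a)).
  rewrite mem_permutations => ba /eqP hb; have [size_b ub] := perm_hyps b ba.
  apply: not_mstd_perm ba _; apply: (run_sound size_b two0 _ _ run_parallelogram).
    by move=> q; apply: trivial_quads_not_held.
  by move=> _ [<-].
(* A parallelogram in any ordering [b] can be moved to the front; the midpoint case uses this for a
   reordered [b]. *)
have {}no4 b q : perm_eq b a -> q \in parallelograms -> ~ holds b q.
  case: q => [[[i j] k] l] ba /perm_arrange_parallelogram pq hq.
  have [size_b _] := perm_hyps b ba; have cb := perm_reorder size_b pq.
  case/negP: no4; apply/hasP; exists [seq b`_m | m <- arrange [:: i; j; k; l]].
    by rewrite mem_permutations (perm_trans cb).
  exact/eqP.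
have [/hasP[[[[i j] k] l] qm /eqP /= hq] | no3] := boolP (has (fun q : quad =>
    let: (i, j, k, l) := q in a`_i + a`_j == a`_k + a`_l) midpoints).
  (* The midpoint goes second, giving the shape a_0 + a_2 = 2 a_1. *)
  have [kl pq] := perm_arrange_midpoint qm; subst l.
  have ba := perm_reorder size_a pq; have [size_b ub] := perm_hyps _ ba.
  apply: not_mstd_perm ba _; apply: (run_sound size_b two0 _ _ run_midpoint).
    move=> q; rewrite mem_cat => /orP[]; first exact: trivial_quads_not_held.
    by apply: no4; apply: perm_reorder.
  by move=> _ [<-].
(* Parallelograms and midpoints are both excluded, so no relation is assumed at the start. *)
apply: (run_sound size_a two0 _ _ run_sidon) => [q|]; last by [].
rewrite mem_cat => /orP[|]; first exact: trivial_quads_not_held.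
rewrite mem_cat => /orP[|qm]; first exact: no4.
case: q qm => [[[i j] k] l] qm hq; case/negP: no3; apply/hasP.
by exists (i, j, k, l); last exact/eqP.
Qed.

Lemma card_imfset2_undup (A : {fset F}) (f : F -> F -> F) :
  #|` [fset f x y | x in A, y in A]%fset| = size (undup [seq f x y | x <- A, y <- A]).
Proof.
apply/perm_size/uniq_perm; rewrite ?fset_uniq ?undup_uniq // => z.
rewrite mem_undup; apply/imfset2P/allpairsP.
  by move=> [x xA [y yA ->]]; exists (x, y).
by move=> [[x y] /= [xA yA ->]]; exists x => //; exists y.
Qed.

End Conclusion.

Local Open Scope fset_scope.

Theorem theorem1p2 (F : fieldType) :
  ~ exists A : {fset F}, #|` A| = 6 /\ MSTD A.
Proof.
case=> A [cardA]; rewrite /MSTD /sumset /diffset !card_imfset2_undup.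
by apply/negP; rewrite -leqNgt; apply: not_mstd_size6 cardA; apply: fset_uniq.
Qed.
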